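(* Let $\alpha,\beta$ be real numbers with $0\le\alpha<\beta$. Then for every real $y>0$, $$|Li_\alpha(iy)|\ \le\ |Li_\beta(iy)| .$$
   Context: For real $\alpha\ge0$, the polylogarithm is $Li_\alpha(z):=\sum_{k=1}^\infty z^k/k^\alpha$ for $|z|<1$, extended analytically to the slit domain $\Lambda:=\mathbb C\setminus[1,\infty)$. The extension is explicitly given, for $z\in\Lambda$, by $Li_0(z)=z/(1-z)$ and, for $\alpha>0$, by $Li_\alpha(z)=\frac{z}{\Gamma(\alpha)}\int_0^1\frac{(\log(1/t))^{\alpha-1}}{1-tz}\,dt$. *)

(* Defs.v *)
From HB Require Import structures.
From mathcomp Require Import all_boot all_order all_algebra.
From mathcomp Require Import all_classical all_reals all_analysis.
From mathcomp Require Import complex.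

Set Implicit Arguments.
Unset Strict Implicit.
Unset Printing Implicit Defensive.

Import Order.TTheory GRing.Theory Num.Theory.
Import numFieldNormedType.Exports.

Local Open Scope classical_set_scope.
Local Open Scope ring_scope.
Local Open Scope complex_scope.

(* Euler's integral; it converges, hence is meaningful, for 0 < a. *)
Definition Gamma (R : realType) (a : R) : R :=
  \int[lebesgue_measure]_(x in `]0, +oo[) (x `^ (a - 1) * expR (- x)).

Definition complex_integral (R : realType) (D : set R) (f : R -> R[i]) : R[i] :=
  (\int[lebesgue_measure]_(t in D) complex.Re (f t))
  +i* (\int[lebesgue_measure]_(t in D) complex.Im (f t)).

(* The principal branch of the polylogarithm on the complex plane slit along
   [1, +oo[, for real order a >= 0, by the explicit formula for the analytic
   continuation of \sum_(k >= 1) z ^+ k / k `^ a from the unit disc. For a > 0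
   and z off the slit, the integrand is absolutely integrable on ]0, 1[.
   Values at a < 0 or at z on the slit carry no meaning. *)
Definition polylog (R : realType) (a : R) (z : R[i]) : R[i] :=
  if a == 0 then z / (1 - z)
  else z / (Gamma a)%:C *
       complex_integral `]0, 1[
         (fun t : R => ((ln t^-1) `^ (a - 1))%:C / (1 - t%:C * z)).

(* Main.v *)
Require Import Defs.
From mathcomp Require Import all_boot all_order all_algebra.
From mathcomp Require Import all_classical all_reals all_analysis.
From mathcomp Require Import measurable_realfun complex ring lra.

Import Order.TTheory GRing.Theory Num.Theory.
Import numFieldNormedType.Exports.

Local Open Scope ring_scope.
Local Open Scope complex_scope.

(* Li_a(iy) / (iy) is the mean H_a of the Cauchy kernel h(t) = 1 / (1 - i y t)
   under the probability density w_a(t) = (ln 1/t)^(a-1) / Gamma(a) on ]0, 1[.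
   For alpha < beta, w_beta = phi w_alpha up to normalization, where
   phi(t) = (ln 1/t)^(beta-alpha) is decreasing.  It suffices that
   Re (conj H_alpha (H_beta - H_alpha)) >= 0.  Up to a positive factor this is
   the triple integral of k(t, s) (phi(t) - phi(x)) against w_alpha(t)
   w_alpha(s) w_alpha(x), where k(t, s) = Re (h(t) conj h(s)), and the sum of
   this integrand over the permutations of (t, s, x) is pointwise nonnegative.
   In the limit case alpha = 0 the density w_0 is the Dirac mass at t = 1. *)

(** * Algebra: the symmetrized Cauchy kernel and a Cauchy-Schwarz step *)

Lemma sym_kernel_ge0 (R : realFieldType) (k12 k13 k23 k22 k33 f1 f2 f3 : R) :
  f3 <= f2 -> f2 <= f1 -> k22 <= k12 -> k33 <= k13 -> 2 * k23 <= k22 + k33 ->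
  k23 <= k12 -> k13 <= k12 ->
  0 <= (k12 - k23) * (f1 - f3) + (k13 - k23) * (f1 - f2)
       + (k12 - k13) * (f2 - f3).
Proof.
move=> f32 f21 h1 h2 h3 h4 h5.
(* Splitting [f1 - f3] as [(f1 - f2) + (f2 - f3)] turns the goal into the sum of [e1] and [e2]. In
   [e1], [2 * k23 <= k22 + k33 <= k12 + k13]. *)
have e1 : 0 <= (f1 - f2) * (k12 + k13 - 2 * k23) by apply: mulr_ge0; lra.
have e2 : 0 <= (f2 - f3) * (k12 - k23 + (k12 - k13)) by apply: mulr_ge0; lra.
lra.
Qed.

Section cauchy_kernel.
Variable R : realFieldType.
Implicit Types t s x y : R.

(* Real and imaginary parts of [1 / (1 - i y t)]. *)
Definition cker_re y t : R := (1 + (y * t) ^+ 2)^-1.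
Definition cker_im y t : R := y * t / (1 + (y * t) ^+ 2).

(** The kernel k(t, s) = Re (h(t) conj h(s)), as an inner product in the plane. *)
Definition cker_dot y t s : R :=
  cker_re y t * cker_re y s + cker_im y t * cker_im y s.

Lemma cker_den_gt0 y t : 0 < 1 + (y * t) ^+ 2.
Proof. by rewrite ltr_pwDl// sqr_ge0. Qed.

Lemma cker_dotE y t s : cker_dot y t s =
  (1 + (y * t) * (y * s)) / ((1 + (y * t) ^+ 2) * (1 + (y * s) ^+ 2)).
Proof.
have := cker_den_gt0 y t; have := cker_den_gt0 y s.
move=> /lt0r_neq0 h1 /lt0r_neq0 h2; rewrite /cker_dot /cker_re /cker_im; field.
by rewrite h1 h2.
Qed.

Lemma cker_dotC y t s : cker_dot y t s = cker_dot y s t.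
Proof. by rewrite /cker_dot; ring. Qed.

Lemma cker_dot_diag y t s : 2 * cker_dot y t s <= cker_dot y t t + cker_dot y s s.
Proof.
rewrite /cker_dot -subr_ge0.
have -> : forall p q r u : R, p * p + r * r + (q * q + u * u) -
  2 * (p * q + r * u) = (p - q) ^+ 2 + (r - u) ^+ 2 by move=> *; ring.
by rewrite addr_ge0 ?sqr_ge0.
Qed.

(** k(t, s) is not monotone in s on the whole half-line. The ordering t <= s <= x is what makes the
    linear factors such as X + S - T nonnegative once the denominators are cleared, with T = y t, S
    = y s, X = y x. *)
Lemma cker_dot_ge y t s x : 0 <= y -> 0 <= t -> t <= s -> s <= x ->
  [/\ cker_dot y s s <= cker_dot y t s,
      cker_dot y s x <= cker_dot y t s &
      cker_dot y t x <= cker_dot y t s].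
Proof.
move=> y0 t0 ts sx.
have dt := cker_den_gt0 y t; have ds := cker_den_gt0 y s.
have dx := cker_den_gt0 y x.
rewrite !cker_dotE.
have T0 : 0 <= y * t by rewrite mulr_ge0.
have TS : y * t <= y * s by rewrite ler_wpM2l.
have SX : y * s <= y * x by rewrite ler_wpM2l.
move: dt ds dx T0 TS SX.
move: (y * t) (y * s) (y * x) => T S X dt ds dx T0 TS SX.
have frac (a b c e : R) : 0 < c -> 0 < e -> a * e <= b * c -> a / c <= b / e.
  by move=> c0 e0 ?; rewrite ler_pdivrMr// mulrAC ler_pdivlMr.
have S0 : 0 <= S by lra.
have X0 : 0 <= X by lra.
have TSX : 0 <= T * S * X by apply: mulr_ge0 => //; exact: mulr_ge0.
split; apply: frac; rewrite ?mulr_gt0// -subr_ge0.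
- rewrite (_ : _ - _ = T * (S - T) * (1 + S^+2)^+2); last by ring.
  by rewrite mulr_ge0 ?sqr_ge0// mulr_ge0// subr_ge0.
- rewrite (_ : _ - _ = (1 + S ^+ 2) * (X - T) * (X + T - S + T * S * X)); last by ring.
  by apply: mulr_ge0; [apply: mulr_ge0; [exact: ltW|lra]|lra].
- rewrite (_ : _ - _ = (1 + T ^+ 2) * (X - S) * (X + S - T + T * S * X)); last by ring.
  by apply: mulr_ge0; [apply: mulr_ge0; [exact: ltW|lra]|lra].
Qed.

(* The sum of [cker_dot y t s * (phi t - phi x)] over the permutations of
   [(t, s, x)]. *)
Lemma cker_sym_ge0 (D : pred R) (phi : R -> R) y : 0 <= y ->
  {in D, forall t, 0 <= t} -> {in D &, {homo phi : t s /~ t <= s}} ->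
  {in D & &, forall t s x, 0 <=
    (cker_dot y t s - cker_dot y s x) * (phi t - phi x) +
    (cker_dot y t x - cker_dot y s x) * (phi t - phi s) +
    (cker_dot y t s - cker_dot y t x) * (phi s - phi x)}.
Proof.
move=> y0 D0 phiD.
have ordered t s x : t \in D -> s \in D -> x \in D -> t <= s -> s <= x -> 0 <=
    (cker_dot y t s - cker_dot y s x) * (phi t - phi x) +
    (cker_dot y t x - cker_dot y s x) * (phi t - phi s) +
    (cker_dot y t s - cker_dot y t x) * (phi s - phi x).
  move=> Dt Ds Dx ts sx.
  have [tt1 tt2 tt3] := cker_dot_ge y t s x y0 (D0 _ Dt) ts sx.
  (* The degenerate triple (t, x, x) yields the bound of k(x, x) by k(t, x). *)
  have [tx _ _] := cker_dot_ge y t x x y0 (D0 _ Dt) (le_trans ts sx) (lexx x).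
  apply: sym_kernel_ge0 (cker_dot_diag y s x) _ _ => //; exact: phiD.
move=> t s x Dt Ds Dx.
(* Since k is symmetric, the sum is invariant under permutations of (t, s, x), so every ordering
   reduces to [ordered]. The two cyclic sign patterns are contradictory, but the same bound closes
   them. *)
have [ts|/ltW ts] := leP t s; have [sx|/ltW sx] := leP s x;
  have [tx|/ltW tx] := leP t x.
- exact: ordered.
- exact: ordered.
- have := ordered _ _ _ Dt Dx Ds tx sx.
  by rewrite (cker_dotC _ x s); lra.
- have := ordered _ _ _ Dx Dt Ds tx ts.
  by rewrite !(cker_dotC _ x); lra.
- have := ordered _ _ _ Ds Dt Dx ts tx.
  by rewrite !(cker_dotC _ s t); lra.
- have := ordered _ _ _ Ds Dx Dt sx tx.
  by rewrite !(cker_dotC _ s t) !(cker_dotC _ x t); lra.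
- have := ordered _ _ _ Dx Ds Dt sx ts.
  by rewrite !(cker_dotC _ s t) !(cker_dotC _ x); lra.
- have := ordered _ _ _ Dx Ds Dt sx ts.
  by rewrite !(cker_dotC _ s t) !(cker_dotC _ x); lra.
Qed.

End cauchy_kernel.

(** For H = (a, b) / g and H' = (a', b') / g', the hypothesis is H . (H' - H) >= 0 without
    denominators. Then |H|^2 <= H . H' <= |H| |H'|, hence |H| <= |H'|. *)
Lemma cauchy_schwarz_ratio (R : realFieldType) (a b g a' b' g' : R) :
  0 <= g' -> 0 <= a * (a' * g - a * g') + b * (b' * g - b * g') ->
  (a ^+ 2 + b ^+ 2) * g' ^+ 2 <= (a' ^+ 2 + b' ^+ 2) * g ^+ 2.
Proof.
move=> g'0 h.
set n := a ^+ 2 + b ^+ 2; set n' := a' ^+ 2 + b' ^+ 2.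
have n0 : 0 <= n by rewrite addr_ge0 ?sqr_ge0.
have n'0 : 0 <= n' by rewrite addr_ge0 ?sqr_ge0.
(* The main argument cancels a factor [n], so [n = 0] is treated apart. *)
have [->|nneq0] := eqVneq n 0; first by rewrite mul0r mulr_ge0 ?sqr_ge0.
have ngt0 : 0 < n by rewrite lt_def nneq0.
rewrite -(ler_pM2l ngt0).
have h1 : n * g' <= (a * a' + b * b') * g by rewrite /n; lra.
have h2 : (n * g') ^+ 2 <= ((a * a' + b * b') * g) ^+ 2.
  have ng'0 : 0 <= n * g' by rewrite mulr_ge0.
  by rewrite lerXn2r// nnegrE (le_trans ng'0 h1).
have h3 : (a * a' + b * b') ^+ 2 * g ^+ 2 <= n * n' * g ^+ 2.
  rewrite ler_wpM2r ?sqr_ge0// -subr_ge0.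
  have -> : n * n' - (a * a' + b * b') ^+ 2 = (a * b' - b * a') ^+ 2.
    by rewrite /n /n'; ring.
  exact: sqr_ge0.
move: h2 h3; rewrite exprMn exprMn => h2 /(le_trans h2).
by rewrite mulrA expr2 !mulrA.
Qed.

(** * A covariance inequality for integrals *)

Section positivity.
Context d (T : measurableType d) (R : realType).
Variables (mu : {measure set T -> \bar R}) (D : set T).
Hypothesis mD : measurable D.

(** Integrates out one variable of a pointwise inequality that is linear in finitely many functions
    of that variable. *)
Lemma Rintegral_lincomb_ge0 n (f : 'I_n -> T -> R) (c : 'I_n -> R) :
  (forall i, mu.-integrable D (EFin \o f i)) ->
  (forall t, D t -> 0 <= \sum_(i < n) c i * f i t) ->
  0 <= \sum_(i < n) c i * \int[mu]_(t in D) f i t.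
Proof.
move=> intf f0.
(* Integrability is carried through the induction, because additivity of the integral needs it for
   the partial sum. *)
suff [_ <-] : mu.-integrable D (EFin \o (fun t => \sum_(i < n) c i * f i t)) /\
    \int[mu]_(t in D) (\sum_(i < n) c i * f i t) =
    \sum_(i < n) c i * \int[mu]_(t in D) f i t.
  exact: Rintegral_ge0.
elim: n f c intf {f0} => [|n IH] f c intf.
  have -> : (fun t => \sum_(i < 0) c i * f i t) = cst 0.
    by apply/funext => t; rewrite big_ord0.
  rewrite big_ord0 Rintegral_cst// mul0r; split => //; exact: integrable0.
have intZ : mu.-integrable D (EFin \o (fun t => c ord_max * f ord_max t)).
  rewrite (_ : _ \o _ = (fun t => (c ord_max)%:E * (EFin \o f ord_max) t)%E)//.
  exact: integrableZl.
have [IH1 IH2] := IH (fun i => f (widen_ord (leqnSn n) i))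
  (fun i => c (widen_ord (leqnSn n) i)) (fun i => intf _).
have -> : (fun t => \sum_(i < n.+1) c i * f i t) =
    (fun t => \sum_(i < n) c (widen_ord (leqnSn n) i) *
      f (widen_ord (leqnSn n) i) t + c ord_max * f ord_max t).
  by apply/funext => t; rewrite big_ord_recr.
rewrite big_ord_recr/= RintegralD//; split; last first.
  by rewrite IH2 RintegralZl.
exact: (integrableD mD IH1 intZ).
Qed.

Local Notation I f := (\int[mu]_(t in D) f t).

(** The symmetrized integrand times w(t) w(s) w(x) is a symmetric trilinear form [S] in the vectors
    [v] at t, s and x. Integrating one vector at a time keeps it nonnegative, so no product measure
    or Fubini argument is needed. *)
Lemma Rintegral_cov_ge0 (w phi a b : T -> R) :
  let k t s := a t * a s + b t * b s in
  (forall t, D t -> 0 <= w t) ->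
  mu.-integrable D (EFin \o w) ->
  mu.-integrable D (EFin \o (fun t => w t * a t)) ->
  mu.-integrable D (EFin \o (fun t => w t * b t)) ->
  mu.-integrable D (EFin \o (fun t => w t * phi t)) ->
  mu.-integrable D (EFin \o (fun t => w t * phi t * a t)) ->
  mu.-integrable D (EFin \o (fun t => w t * phi t * b t)) ->
  (forall t s x, D t -> D s -> D x -> 0 <=
    (k t s - k s x) * (phi t - phi x) + (k t x - k s x) * (phi t - phi s)
    + (k t s - k t x) * (phi s - phi x)) ->
  0 <= I (fun t => w t * a t) *
         (I (fun t => w t * phi t * a t) * I w
          - I (fun t => w t * a t) * I (fun t => w t * phi t))
     + I (fun t => w t * b t) *
         (I (fun t => w t * phi t * b t) * I w
          - I (fun t => w t * b t) * I (fun t => w t * phi t)).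
Proof.
move=> k w0 iw ia ib iwp ipa ipb kD.
(* The default [w] of [nth] serves as the sixth component, at index 5. *)
pose v : nat -> T -> R := nth w [:: fun t => w t * phi t * a t;
  fun t => w t * phi t * b t; fun t => w t * phi t;
  fun t => w t * a t; fun t => w t * b t].
pose Iv i := I (v i).
(* [co u z] are the coefficients, in the first vector, of the symmetrized
   trilinear form. *)
pose co (u z : nat -> R) := nth 0 [:: u 3%N * z 5%N + z 3%N * u 5%N;
  u 4%N * z 5%N + z 4%N * u 5%N; - 2 * (u 3%N * z 3%N + u 4%N * z 4%N);
  u 0%N * z 5%N + z 0%N * u 5%N - 2 * (u 3%N * z 2%N + z 3%N * u 2%N);
  u 1%N * z 5%N + z 1%N * u 5%N - 2 * (u 4%N * z 2%N + z 4%N * u 2%N);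
  u 3%N * z 0%N + u 4%N * z 1%N + z 3%N * u 0%N + z 4%N * u 1%N].
pose S (x u z : nat -> R) := \sum_(i < 6) co u z i * x i.
have SE x u z : S x u z = (u 3%N * z 5%N + z 3%N * u 5%N) * x 0%N +
  (u 4%N * z 5%N + z 4%N * u 5%N) * x 1%N + (- 2 * (u 3%N * z 3%N + u 4%N * z 4%N)) * x 2%N +
  (u 0%N * z 5%N + z 0%N * u 5%N - 2 * (u 3%N * z 2%N + z 3%N * u 2%N)) * x 3%N +
  (u 1%N * z 5%N + z 1%N * u 5%N - 2 * (u 4%N * z 2%N + z 4%N * u 2%N)) * x 4%N +
  (u 3%N * z 0%N + u 4%N * z 1%N + z 3%N * u 0%N + z 4%N * u 1%N) * x 5%N.
  by rewrite /S !big_ord_recr big_ord0 /= add0r.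
have SC x u z : S x u z = S u x z by rewrite !SE; ring.
have SC' x u z : S x u z = S z u x by rewrite !SE; ring.
have iv i : (i < 6)%N -> mu.-integrable D (EFin \o v i).
  by case: i => [|[|[|[|[|[|]]]]]].
have Sint u z : (forall t, D t -> 0 <= S (v ^~ t) u z) -> 0 <= S Iv u z.
  by move=> h; apply: Rintegral_lincomb_ge0 => // i; exact: iv.
have S1 s x : D s -> D x -> 0 <= S Iv (v ^~ s) (v ^~ x).
  move=> Ds Dx; apply: Sint => t Dt.
  rewrite (_ : S _ _ _ = w t * w s * w x * ((k t s - k s x) * (phi t - phi x)
    + (k t x - k s x) * (phi t - phi s) + (k t s - k t x) * (phi s - phi x))).
    by rewrite mulr_ge0 ?kD// mulr_ge0 ?w0// mulr_ge0 ?w0.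
  by rewrite SE /v /k /=; ring.
have S2 x : D x -> 0 <= S Iv Iv (v ^~ x).
  by move=> Dx; apply: Sint => t Dt; rewrite SC S1.
have : 0 <= S Iv Iv Iv by apply: Sint => t Dt; rewrite SC' S2.
(* At three equal vectors the six permutations contribute equally, hence the factor 6. *)
rewrite SE /Iv /v/= => h; rewrite -(@pmulr_rge0 _ 6)//.
by apply: le_trans h _; rewrite le_eqVlt; apply/orP; left; apply/eqP; ring.
Qed.
End positivity.

(** * Convergence of Euler's integral *)

Section gamma.
Local Open Scope classical_set_scope.
Variable R : realType.
Implicit Types a x y u v t : R.

(** By concavity, the graph of p ln lies below its tangent at p, which has slope 1. *)
Lemma mulr_ln_le p x : 0 < p -> 0 < x -> p * ln x <= x - p + p * ln p.
Proof.
move=> p0 x0; have xp0 : 0 < x / p by rewrite divr_gt0.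
have h : x / p - 1 >= ln (x / p).
  rewrite -ler_expR lnK//; have := expR_ge1Dx (x / p - 1).
  by rewrite addrC subrK.
have -> : p * ln x = p * ln (x / p) + p * ln p.
  by rewrite ln_div ?posrE//; ring.
rewrite lerD2r (le_trans (ler_wpM2l (ltW p0) h))// mulrBr mulr1 mulrCA divff ?gt_eqF//.
by rewrite mulr1.
Qed.

(* [(x / (1 + x)) `^ a]: bounded on the half-line, and its derivative dominates
   the integrand of Gamma up to a constant. *)
Definition Gamma_majorant a x : R := expR (a * (ln x - ln (1 + x))).

Lemma is_derive_Gamma_majorant a x : 0 < x ->
  is_derive x 1 (Gamma_majorant a) (a * Gamma_majorant a x / (x * (1 + x))).
Proof.
move=> x0.
have x1 : 0 < 1 + x by rewrite addr_gt0.
have h1 := is_derive1_ln x0.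
have h2 := is_derive1_ln x1.
apply: is_derive_eq; rewrite /Gamma_majorant add0r mulr1 /GRing.scale/=.
by field; rewrite !gt_eqF.
Qed.

(** After cancellation this says that (1 + x)^(a+1) e^(-x) is at most its value at x = a, which is
    the exponential constant. The factor 1/a offsets the a in the derivative of [Gamma_majorant]. *)
Lemma integrand_Gamma_le a x : 0 < a -> 0 < x ->
  x `^ (a - 1) * expR (- x) <=
  expR (- a + (a + 1) * ln (a + 1)) / a * (a * Gamma_majorant a x / (x * (1 + x))).
Proof.
move=> a0 x0.
have x1 : 0 < 1 + x by rewrite addr_gt0.
have a1 : 0 < a + 1 by rewrite addr_gt0.
have -> : expR (- a + (a + 1) * ln (a + 1)) / a * (a * Gamma_majorant a x / (x * (1 + x))) =
    expR (- a + (a + 1) * ln (a + 1)) * Gamma_majorant a x / (x * (1 + x)).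
  by field; rewrite !gt_eqF.
rewrite -[X in _ / X]lnK ?posrE ?mulr_gt0// -expRN /Gamma_majorant -!expRD /powR gt_eqF//.
rewrite -expRD ler_expR lnM ?posrE//.
by have := mulr_ln_le _ _ a1 x1; lra.
Qed.

Lemma measurable_integrand_Gamma a (D : set R) :
  measurable_fun D (fun x => (x `^ (a - 1) * expR (- x))%:E).
Proof.
apply/measurable_EFinP/measurable_funTS; apply: measurable_funM.
  exact: measurable_powR.
by apply: measurableT_comp => //; exact: measurable_oppr.
Qed.

(** The shift by 2 keeps the left endpoint strictly below the right one already at n = 0. *)
Definition itv0y n : set R := `[n.+2%:R^-1, n.+2%:R].

Lemma continuous_integrand_Gamma a x : 0 < x ->
  {for x, continuous (fun x => x `^ (a - 1) * expR (- x))}.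
Proof.
move=> x0; apply/differentiable_continuous/derivable1_diffP.
by apply: ex_derive; apply: is_deriveM; exact: is_derive1_powR.
Qed.

(** The bound is uniform in u and v: the integrand is dominated by the derivative of
    [C * Gamma_majorant a], whose increment is at most [C] because [Gamma_majorant] takes values
    between 0 and 1. *)
Lemma integral_Gamma_itv_le a u v : 0 < a -> 0 < u -> u < v ->
  (\int[lebesgue_measure]_(x in `[u, v]) (x `^ (a - 1) * expR (- x))%:E <=
   (expR (- a + (a + 1) * ln (a + 1)) / a)%:E)%E.
Proof.
move=> a0 u0 uv.
set C := _ / a.
have C0 : 0 <= C by rewrite divr_ge0 ?expR_ge0 ?ltW.
pose f x := C * (a * Gamma_majorant a x / (x * (1 + x))).
have pos x : x \in `[u, v]%R -> 0 < x.
  by rewrite in_itv/= => /andP[+ _]; exact: lt_le_trans.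
have dM x : 0 < x -> is_derive x 1 (fun x => C * Gamma_majorant a x) (f x).
  by move=> x0; have := is_derive_Gamma_majorant a x x0 => ?; exact: is_deriveZ.
have cM x : 0 < x -> {for x, continuous (fun x => C * Gamma_majorant a x)}.
  move=> x0; apply/differentiable_continuous/derivable1_diffP.
  by have := dM x x0 => -[].
have cf x : 0 < x -> {for x, continuous f}.
  move=> x0; apply/differentiable_continuous/derivable1_diffP.
  have [d1 _] := is_derive_Gamma_majorant a x x0.
  have x1 : x * (1 + x) != 0 by rewrite mulf_neq0 ?gt_eqF// addr_gt0.
  apply: derivableM => //; apply: derivableM; first exact: derivableM.
  exact: derivableV.
have cw (h : R -> R) : (forall x, 0 < x -> {for x, continuous h}) ->
    {within `[u, v], continuous h}.
  by move=> ch; apply: continuous_in_subspaceT => x /[!inE]/= xuv; exact/ch/pos.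
apply: (@le_trans _ _ (\int[lebesgue_measure]_(x in `[u, v]) (f x)%:E)%E).
  apply: ge0_le_integral; rewrite /=.
  - exact: measurable_itv.
  - by move=> x _; rewrite lee_fin mulr_ge0 ?powR_ge0 ?expR_ge0.
  - exact: measurable_integrand_Gamma.
  - apply/measurable_EFinP; apply: subspace_continuous_measurable_fun.
      exact: measurable_itv.
    exact: cw.
  - by move=> x xuv; have x0 := pos x xuv; rewrite lee_fin; exact: integrand_Gamma_le.
rewrite (@continuous_FTC2 _ f (fun x => C * Gamma_majorant a x))//; last 3 first.
- exact: cw.
- split.
  + by move=> x /subset_itv_oo_cc xuv; have x0 := pos x xuv; have := dM x x0 => -[].
  + exact/cvg_at_right_filter/cM.
  + exact/cvg_at_left_filter/cM/(lt_trans u0).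
- move=> x /subset_itv_oo_cc xuv; have x0 := pos x xuv; rewrite derive1E.
  by have := dM x x0 => -[].
rewrite -EFinB lee_fin lerBlDr (@le_trans _ _ C)//; last first.
  by rewrite lerDl mulr_ge0 ?expR_ge0.
rewrite ler_piMr// /Gamma_majorant -expR0 ler_expR pmulr_rle0// subr_le0.
have v0 := lt_trans u0 uv.
by rewrite ler_ln ?posrE ?addr_gt0// lerDr.
Qed.

Lemma exists_itv0y x : 0 < x -> exists n, x \in `[n.+2%:R^-1, n.+2%:R]%R.
Proof.
(* The sum x + 1/x dominates both x and 1/x, so a single integer handles both endpoints. *)
move=> x0; exists (Num.truncn (x + x^-1)).
have xN : x + x^-1 < (Num.truncn (x + x^-1)).+2%:R.
  by rewrite (lt_trans (Num.Theory.truncnS_gt _))// ltr_nat.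
move: xN; set N := _%:R => xN.
have x'0 : 0 < x^-1 by rewrite invr_gt0.
rewrite in_itv/= invf_ple ?posrE// ?(lt_trans _ xN) ?addr_gt0//.
by apply/andP; split; lra.
Qed.

Lemma itv0y_homo : {homo itv0y : m n / (m <= n)%N >-> (m <= n)%O}.
Proof.
move=> m n mn; apply/subsetPset => x; rewrite /itv0y/= !in_itv/= => /andP[mx xm].
have mnR : m.+2%:R <= n.+2%:R :> R by rewrite ler_nat.
rewrite (le_trans xm mnR) andbT (le_trans _ mx)// lef_pV2 ?posrE//.
Qed.

Lemma bigcup_itv0y : \bigcup_n itv0y n = `]0, +oo[.
Proof.
apply/seteqP; split => x /=; rewrite ?in_itv/= ?andbT.
  by move=> [n _]; rewrite /itv0y /= in_itv/= => /andP[+ _]; apply: lt_le_trans.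
by move=> /exists_itv0y[n xn]; exists n.
Qed.

Lemma itv0y_lt n : n.+2%:R^-1 < n.+2%:R :> R.
Proof. by rewrite invf_plt ?posrE// (@lt_trans _ _ 1)// ?invf_lt1 ?ltr1n. Qed.

Lemma cvg_integral_Gamma a :
  (\int[lebesgue_measure]_(x in itv0y n) (x `^ (a - 1) * expR (- x))%:E
    @[n --> \oo] --> \int[lebesgue_measure]_(x in \bigcup_n itv0y n)
      (x `^ (a - 1) * expR (- x))%:E)%E.
Proof.
apply: ge0_nondecreasing_set_cvg_integral.
- exact: itv0y_homo.
- by move=> n; exact: measurable_itv.
- by move=> n; exact: measurable_integrand_Gamma.
- by move=> n x _; rewrite lee_fin mulr_ge0 ?powR_ge0 ?expR_ge0.
Qed.

Lemma integral_Gamma_lty a : 0 < a ->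
  (\int[lebesgue_measure]_(x in `]0%R, +oo[) (x `^ (a - 1) * expR (- x))%:E
   < +oo)%E.
Proof.
move=> a0; rewrite -bigcup_itv0y.
apply: le_lt_trans (ltry (expR (- a + (a + 1) * ln (a + 1)) / a)).
have h := cvg_integral_Gamma a.
rewrite -(cvg_lim _ h)//; apply: lime_le; first by apply/cvg_ex; eexists; exact: h.
apply: nearW => n; apply: integral_Gamma_itv_le => //.
exact: itv0y_lt.
Qed.

(** * The substitution t = e^(-x), from ]0, +oo[ to ]0, 1[, and positivity of Gamma *)

Definition itv01 n : set R := `[expR (- n.+2%:R), expR (- n.+2%:R^-1)].

Lemma itv01E t n : 0 < t -> itv01 n t = itv0y n (- ln t).
Proof.
move=> t0; rewrite /itv01 /itv0y /= !in_itv/= -{1 2}(@lnK _ t) ?posrE// !ler_expR.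
by rewrite -lerN2 opprK andbC -(lerN2 _ (ln t)) opprK.
Qed.

Lemma itv01_homo : {homo itv01 : m n / (m <= n)%N >-> (m <= n)%O}.
Proof.
move=> m n mn; apply/subsetPset => t t01.
have t0 : 0 < t.
  by move: t01; rewrite /itv01/= in_itv/= => /andP[+ _]; apply: lt_le_trans; exact: expR_gt0.
by move: t01; rewrite !itv01E//; move/subsetPset : (itv0y_homo _ _ mn); apply.
Qed.

Lemma bigcup_itv01 : \bigcup_n itv01 n = `]0, 1[.
Proof.
apply/seteqP; split => t /=; rewrite ?in_itv/= ?andbT.
  move=> [n _]; rewrite /itv01 /= in_itv/= => /andP[+ +].
  by move=> /(lt_le_trans (expR_gt0 _)) -> /le_lt_trans ->.
move=> /andP[t0 t1].
have : 0 < - ln t by rewrite oppr_gt0 ln_lt0// t0.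
by move=> /exists_itv0y[n xn]; exists n => //; rewrite itv01E.
Qed.

Lemma measurable_polylog_weight a :
  measurable_fun (`]0, 1[ : set R) (fun t => (ln t^-1) `^ (a - 1)).
Proof.
apply: (eq_measurable_fun (fun t => (- ln t) `^ (a - 1))).
  by move=> t; rewrite inE/= in_itv/= => /andP[t0 _]; rewrite lnV.
apply/measurable_funTS; apply: (measurableT_comp (measurable_powR (a - 1))).
by apply: measurableT_comp => //; exact: measurable_oppr.
Qed.

(** The weight may blow up at either end of ]0, 1[, so the substitution is made on the compact
    intervals [itv0y n] and [itv01 n], and monotone convergence gives the limit on both sides. The
    equality is in the extended reals, for every real a. *)
Lemma integral_polylog_weight a :
  (\int[lebesgue_measure]_(t in `]0%R, 1%R[) ((ln t^-1) `^ (a - 1))%:E =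
   \int[lebesgue_measure]_(x in `]0%R, +oo[) (x `^ (a - 1) * expR (- x))%:E)%E.
Proof.
rewrite -bigcup_itv0y -bigcup_itv01.
have hK := cvg_integral_Gamma a.
have hL : (\int[lebesgue_measure]_(t in itv01 n) ((ln t^-1) `^ (a - 1))%:E
    @[n --> \oo] --> \int[lebesgue_measure]_(t in \bigcup_n itv01 n)
      ((ln t^-1) `^ (a - 1))%:E)%E.
  apply: ge0_nondecreasing_set_cvg_integral.
  - exact: itv01_homo.
  - by move=> n; exact: measurable_itv.
  - move=> n; apply/measurable_EFinP.
    apply: (measurable_funS _ _ (measurable_polylog_weight a)); first exact: measurable_itv.
    by rewrite -bigcup_itv01; exact: bigcup_sup.
  - by move=> n x _; rewrite lee_fin powR_ge0.
rewrite -(cvg_lim _ hL)// -(cvg_lim _ hK)//.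
congr (limn _); apply/funext => n.
have dF (x : R) : is_derive x 1 (fun x => expR (- x)) (- expR (- x)).
  by apply: is_derive_eq; rewrite /GRing.scale/= mulrN1.
have dFE : (fun x : R => expR (- x))^`() = (fun x => - expR (- x)).
  by apply/funext => x; rewrite derive1E; have := dF x => -[].
have cF : continuous (fun x : R => expR (- x)).
  by move=> x; apply: continuous_comp; [exact: opp_continuous|exact: continuous_expR].
have cN : continuous (fun x : R => - expR (- x)).
  by move=> x; apply: cvgN; exact: cF.
rewrite /itv01 (@integration_by_substitution_decreasing _ (fun x => expR (- x))).
- apply: eq_integral => x; rewrite inE => x0y.
  by rewrite dFE !fctE opprK lnV ?posrE ?expR_gt0// expRK opprK.
- exact/ltW/itv0y_lt.
- by move=> x y _ _ xy; rewrite ltr_expR ltrN2.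
- by move=> x _; rewrite dFE; exact: cN.
- by rewrite dFE; apply/cvg_ex; eexists; exact/cvg_at_right_filter/cN.
- by rewrite dFE; apply/cvg_ex; eexists; exact/cvg_at_left_filter/cN.
- split; first by move=> x _; have := dF x => -[].
    exact/cvg_at_right_filter/cF.
  exact/cvg_at_left_filter/cF.
- apply: continuous_in_subspaceT => t; rewrite inE => t01.
  have : (`]0, 1[%classic : set R) t by rewrite -bigcup_itv01; exists n.
  rewrite /= in_itv/= => /andP[t0 t1].
  have l0 : 0 < ln t^-1 by rewrite lnV ?posrE// oppr_gt0 ln_lt0// t0.
  apply: (@continuous_comp _ _ _ (fun t : R => ln t^-1) (@powR R ^~ (a - 1))).
    apply: (@continuous_comp _ _ _ (@GRing.inv R) (@ln R)).
      by apply: inv_continuous; rewrite gt_eqF.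
    by apply: continuous_ln; rewrite invr_gt0.
  apply/differentiable_continuous/derivable1_diffP.
  by apply: ex_derive; exact: is_derive1_powR.
Qed.

Lemma integrable_polylog_weight a : 0 < a ->
  lebesgue_measure.-integrable `]0%R, 1%R[
    (EFin \o (fun t : R => (ln t^-1) `^ (a - 1))).
Proof.
move=> a0; apply/integrableP; split.
  by apply/measurable_EFinP; exact: measurable_polylog_weight.
under eq_integral do rewrite /= ger0_norm ?powR_ge0//.
by rewrite integral_polylog_weight integral_Gamma_lty.
Qed.

Lemma GammaE a :
  Gamma a = \int[lebesgue_measure]_(t in `]0, 1[) ((ln t^-1) `^ (a - 1)).
Proof. by rewrite /Gamma /Rintegral integral_polylog_weight. Qed.

(** If the integral vanished, the nonnegative weight would be zero almost everywhere on ]0, 1[, yet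
    it is positive there and the interval has measure 1. *)
Lemma Gamma_gt0 a : 0 < a -> 0 < Gamma a.
Proof.
move=> a0; rewrite lt_def Rintegral_ge0 ?andbT; last first.
  by move=> x _; rewrite mulr_ge0 ?powR_ge0 ?expR_ge0.
rewrite GammaE; apply/eqP => G0.
have : (\int[lebesgue_measure]_(t in `]0%R, 1%R[) `|((ln t^-1) `^ (a - 1))%:E| = 0)%E.
  under eq_integral do rewrite /= ger0_norm ?powR_ge0//.
  rewrite -[LHS]fineK; first by congr EFin.
  exact: integrable_fin_num (integrable_polylog_weight a a0).
move=> /ae_eq_integral_abs => /(_ _ _)[].
- exact: measurable_itv.
- by apply/measurable_EFinP; exact: measurable_polylog_weight.
move=> N [mN N0 sub].
have : lebesgue_measure (`]0%R, 1%R[ : set R) = 0%E.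
  apply: (subset_measure0 _ mN _ N0); first exact: measurable_itv.
  move=> t tI; apply: sub => /= /(_ tI) /eqP; apply/negP.
  move: tI; rewrite /= in_itv/= => /andP[t0 t1].
  rewrite eqe gt_eqF// powR_gt0// lnV ?posrE// oppr_gt0 ln_lt0// t0//.
rewrite lebesgue_measure_itv/= lte01 -EFinB subr0 => -[/eqP].
by rewrite oner_eq0.
Qed.

End gamma.

(** * Polylogarithms on the imaginary axis and their comparison *)

Section polylog_imaginary.
Variable R : realType.
Implicit Types a y t : R.

Let w a t := (ln t^-1) `^ (a - 1).

Let I (f : R -> R) := \int[lebesgue_measure]_(t in `]0, 1[%classic) f t.

Lemma complex_cker a y t : a%:C / (1 - t%:C * (0 +i* y)) =
  (a * cker_re R y t) +i* (a * cker_im R y t).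
Proof.
have d0 : 1 - t%:C * (0 +i* y) != 0.
  by rewrite eq_complex negb_and /=; apply/orP; left; rewrite mulr0 mul0r !subr0 oner_eq0.
apply: (mulIf d0); rewrite divfK//; apply/eqP; rewrite eq_complex /=.
rewrite /cker_re /cker_im; have := cker_den_gt0 R y t => /lt0r_neq0 ?.
by apply/andP; split; apply/eqP; field.
Qed.

(** Writing the modulus as an embedded real with y factored out turns the comparison in [R[i]] into
    one between real means of the kernel. *)
Lemma norm_polylog_imaginary a y : 0 < a -> 0 < y ->
  `|polylog a (0 +i* y)| = (y * (Num.sqrt
    (I (fun t => w a t * cker_re R y t) ^+ 2 +
     I (fun t => w a t * cker_im R y t) ^+ 2) / Gamma a))%:C.
Proof.
move=> a0 y0; rewrite /polylog gt_eqF// !normrM normfV.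
have -> : complex_integral `]0, 1[%classic
    (fun t : R => ((ln t^-1) `^ (a - 1))%:C / (1 - t%:C * (0 +i* y))) =
    I (fun t => w a t * cker_re R y t) +i* I (fun t => w a t * cker_im R y t).
  by rewrite /complex_integral; congr (_ +i* _); apply: eq_Rintegral => t _;
    rewrite complex_cker.
rewrite !normc_def /= expr0n add0r !addr0 /= !sqrtr_sqr.
rewrite (gtr0_norm y0) (gtr0_norm (Gamma_gt0 R a a0)).
by rewrite -fmorphV -!rmorphM /= mulrAC mulrA.
Qed.

Lemma norm_polylog0_imaginary y : 0 < y ->
  `|polylog 0 (0 +i* y)| = (y * Num.sqrt (1 + y ^+ 2)^-1)%:C.
Proof.
move=> y0; rewrite /polylog eqxx normrM normfV.
have -> : 1 - (0 +i* y) = 1 +i* (- y) :> R[i].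
  by apply/eqP; rewrite eq_complex /= subr0 sub0r !eqxx.
rewrite !normc_def /= expr0n add0r expr1n sqrrN sqrtr_sqr (gtr0_norm y0).
by rewrite -fmorphV -rmorphM /= sqrtrV// addr_ge0// sqr_ge0.
Qed.

(** Both parts of the kernel are continuous and bounded by 1, so the weight dominates. For the
    imaginary part the bound is |u| <= 1 + u^2 with u = y t. *)
Lemma integrable_weight_cker a y : 0 < a ->
  lebesgue_measure.-integrable `]0%R, 1%R[%classic
    (EFin \o (fun t => w a t * cker_re R y t)) /\
  lebesgue_measure.-integrable `]0%R, 1%R[%classic
    (EFin \o (fun t => w a t * cker_im R y t)).
Proof.
move=> a0; have iw := integrable_polylog_weight R a a0.
have mw := measurable_polylog_weight R a.
have dP t := cker_den_gt0 R y t.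
have cden : continuous (fun t => 1 + (y * t) ^+ 2).
  move=> t; apply/differentiable_continuous/derivable1_diffP.
  exact: ex_derive.
have cre : continuous (cker_re R y).
  by move=> t; apply: (@continuous_comp _ _ _ (fun t => 1 + (y * t) ^+ 2) (@GRing.inv R));
    [exact: cden|apply: inv_continuous; rewrite gt_eqF].
have cim : continuous (cker_im R y).
  by move=> t; apply: continuousM; [exact: mulrl_continuous|exact: cre].
have w0 t : 0 <= w a t by exact: powR_ge0.
have dom (h : R -> R) : continuous h -> (forall t, `|h t| <= 1) ->
  lebesgue_measure.-integrable `]0%R, 1%R[%classic (EFin \o (fun t => w a t * h t)).
  move=> ch h1; apply: le_integrable iw => //.
    apply/measurable_EFinP; apply: measurable_funM => //.
    by apply: measurable_funTS; exact: continuous_measurable_fun.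
  move=> t _; rewrite lee_fin normrM ler_piMr//.
split; apply: dom => // t.
  by rewrite /cker_re gtr0_norm ?invr_gt0// invf_le1// lerDl sqr_ge0.
rewrite /cker_im normrM normfV (gtr0_norm (dP t)) ler_pdivrMr// mul1r.
rewrite -[(y * t) ^+ 2]real_normK ?num_real//.
by have := sqr_ge0 (`|y * t| - 1); have := normr_ge0 (y * t); nra.
Qed.

End polylog_imaginary.

(* The order on R[i] is the partial order of its numClosedFieldType structure;
   both sides are nonnegative reals, where it is the order of R. *)
Theorem corollary1p4 (R : realType) (alpha beta : R)
    (halpha : 0 <= alpha) (hlt : alpha < beta) (y : R) (hy : 0 < y) :
  `|polylog alpha (0 +i* y)| <= `|polylog beta (0 +i* y)|.
Proof.
have b0 : 0 < beta by exact: le_lt_trans hlt.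
have gb := Gamma_gt0 R beta b0.
have [ibre ibim] := integrable_weight_cker R beta y b0.
have ib := integrable_polylog_weight R beta b0.
rewrite (norm_polylog_imaginary R beta)//.
set A' := Rintegral _ _ _; set B' := Rintegral _ _ _.
move: halpha; rewrite le_eqVlt => /predU1P[<-|a0].
  rewrite norm_polylog0_imaginary// lecR ler_pM2l// ler_pdivlMr//.
  (* Here H_0 = h(1) is a positive multiple of (1, y). The inner product of h(t) with (1, y) is (1 +
     y^2 t) / (1 + y^2 t^2), which is at least 1 because t^2 <= t on ]0, 1[. *)
  have h : Gamma beta <= A' + y * B'.
    have iy : lebesgue_measure.-integrable `]0%R, 1%R[%classic (EFin \o
        (fun t => y * ((ln t^-1) `^ (beta - 1) * cker_im R y t))).
      rewrite (_ : _ \o _ = (fun t => y%:E * (EFin \o (fun t =>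
        (ln t^-1) `^ (beta - 1) * cker_im R y t)%R) t)%E)//.
      by apply: integrableZl => //; exact: measurable_itv.
    rewrite /A' /B' -RintegralZl// -RintegralD//.
    rewrite GammaE; apply: le_Rintegral => //.
      by apply: (integrableD _ ibre iy); exact: measurable_itv.
    move=> t /=; rewrite in_itv/= => /andP[t0 t1].
    have dP := cker_den_gt0 R y t.
    have -> : forall w, w * cker_re R y t + y * (w * cker_im R y t) =
        w * ((1 + y ^+ 2 * t) / (1 + (y * t) ^+ 2)).
      by move=> w; rewrite /cker_re /cker_im; field; rewrite gt_eqF.
    rewrite ler_peMr ?powR_ge0// ler_pdivlMr// mul1r lerD2l exprMn.
    by rewrite ler_wpM2l ?sqr_ge0// expr2 ler_piMr ?ltW.
  have y1 : 0 < 1 + y ^+ 2 by rewrite ltr_pwDl// sqr_ge0.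
  rewrite -(@ler_pXn2r _ 2)// ?nnegrE ?mulr_ge0 ?sqrtr_ge0 ?(ltW gb)//.
  rewrite exprMn !sqr_sqrtr ?invr_ge0 ?(ltW y1) ?addr_ge0 ?sqr_ge0//.
  rewrite mulrC ler_pdivrMr//.
  have h2 : Gamma beta ^+ 2 <= (A' + y * B') ^+ 2.
    by rewrite lerXn2r// nnegrE ?(ltW gb)// (le_trans _ h)// ltW.
  (* What remains is Cauchy-Schwarz for (1, y) and (A', B'), whose defect is the square of y A' -
     B'. *)
  apply: le_trans h2 _; rewrite -subr_ge0.
  rewrite (_ : _ - _ = (y * A' - B') ^+ 2) ?sqr_ge0//; ring.
have ga := Gamma_gt0 R alpha a0.
have [iare iaim] := integrable_weight_cker R alpha y a0.
have ia := integrable_polylog_weight R alpha a0.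
rewrite norm_polylog_imaginary// lecR ler_pM2l//.
set A := Rintegral _ _ _; set B := Rintegral _ _ _.
rewrite ler_pdivrMr// mulrAC ler_pdivlMr//.
(* Up to a positive factor, this is the inner product of H_alpha with H_beta - H_alpha. *)
suff h : 0 <= A * (A' * Gamma alpha - A * Gamma beta) +
              B * (B' * Gamma alpha - B * Gamma beta).
  have cs := cauchy_schwarz_ratio _ _ _ _ _ _ _ (ltW gb) h.
  rewrite -(@ler_pXn2r _ 2)// ?nnegrE ?mulr_ge0 ?sqrtr_ge0 ?(ltW gb) ?(ltW ga)//.
  by rewrite !exprMn !sqr_sqrtr// addr_ge0 ?sqr_ge0.
pose phi (t : R) := (ln t^-1) `^ (beta - alpha).
have l0 t : t \in (`]0, 1[ : interval R) -> 0 < ln t^-1.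
  by rewrite in_itv/= => /andP[t0 t1]; rewrite lnV ?posrE// oppr_gt0 ln_lt0// t0.
have wphi t : t \in (`]0, 1[ : interval R) ->
    (ln t^-1) `^ (beta - 1) = (ln t^-1) `^ (alpha - 1) * phi t.
  move=> tI; rewrite /phi -powRD ?(gt_eqF (l0 t tI)) ?implybT//.
  by congr (_ `^ _); ring.
have phi_homo : {in (`]0, 1[ : interval R) &, {homo phi : t s /~ t <= s}}.
  move=> t s tI sI ts; rewrite /phi ge0_ler_powR// ?nnegrE ?(ltW (l0 _ _))//.
    by rewrite subr_ge0 ltW.
  move: tI sI; rewrite !in_itv/= => /andP[t0 _] /andP[s0 _].
  by rewrite ler_ln ?posrE ?invr_gt0// lef_pV2 ?posrE.
have eqI (f : R -> R) : \int[lebesgue_measure]_(t in `]0, 1[%classic)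
    ((ln t^-1) `^ (beta - 1) * f t) = \int[lebesgue_measure]_(t in `]0, 1[%classic)
    ((ln t^-1) `^ (alpha - 1) * phi t * f t).
  by apply: eq_Rintegral => t; rewrite inE/= => tI; rewrite wphi.
have eqi (f g : R -> R) : (forall t, t \in (`]0, 1[ : interval R) -> f t = g t) ->
    lebesgue_measure.-integrable `]0%R, 1%R[%classic (EFin \o f) ->
    lebesgue_measure.-integrable `]0%R, 1%R[%classic (EFin \o g).
  move=> fg; apply: eq_integrable => // t; rewrite inE/= => tI.
  by congr EFin; exact: fg.
have gE : Gamma beta = \int[lebesgue_measure]_(t in `]0, 1[%classic)
    ((ln t^-1) `^ (alpha - 1) * phi t).
  by rewrite GammaE; apply: eq_Rintegral => t; rewrite inE/= => tI; rewrite wphi.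
(* Every integral is now taken against the weight of alpha, with phi as an extra factor, which is
   the shape of the covariance inequality. *)
rewrite /A' /B' !eqI gE (GammaE R alpha).
apply: Rintegral_cov_ge0 => //.
- by move=> t _; exact: powR_ge0.
- by apply: eqi ib => t tI; rewrite wphi.
- by apply: eqi ibre => t tI; rewrite wphi.
- by apply: eqi ibim => t tI; rewrite wphi.
- move=> t s x tI sI xI.
  apply: (cker_sym_ge0 R (mem (`]0, 1[ : interval R)) phi y (ltW hy)) => //.
  by move=> u; rewrite in_itv/= => /andP[/ltW].
Qed.
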